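(* Let $q$ be a prime power, $n\geq 2$ an integer, let $W=\{\omega_j:0\leq j\leq n-1\}$ be any basis for $\mathbb{F}_{q^n}$ over $\mathbb{F}_q$, and let $B=\{\beta_j:0\leq j\leq n-1\}$ be the dual basis of $W$. For $0\leq j\leq n-1$, define \begin{align*} S_{W,j}&=\bigl\{y\in\mathbb{F}_{q^n}^\ast:\mathrm{Tr}_q^{q^n}(\beta_jy)\neq 0\text{ and }\mathrm{Tr}_q^{q^n}(\beta_iy)=0\text{ for all }i\geq j+1\bigr\};\\ Z_{W,j}&=\bigl\{x\in\mu_{\frac{q^n-1}{q-1}}:T_{W,j}(x)\neq 0\text{ and }T_{W,i}(x)=0\text{ for all }i\geq j+1\bigr\};\\ \overline{C_{q,n,j}}&=\biggl\{\biggl(\frac{\mathrm{Tr}_q^{q^n}(\beta_0x)}{\mathrm{Tr}_q^{q^n}(\beta_jx)}:\dots:\frac{\mathrm{Tr}_q^{q^n}(\beta_{j-1}x)}{\mathrm{Tr}_q^{q^n}(\beta_jx)}:1:0:\dots:0\biggr):x\in S_{W,j}\biggr\}. \end{align*} Then we have the following partitions (disjoint unions): $$\mathbb{F}_{q^n}^\ast=\bigsqcup_{j=0}^{n-1}S_{W,j};\quad \mu_{\frac{q^n-1}{q-1}}=\bigsqcup_{j=0}^{n-1}Z_{W,j};\quad \mathrm{PG}(n-1,q)=\bigsqcup_{j=0}^{n-1}\overline{C_{q,n,j}}.$$ Moreover, for $0\leq j\leq n-1$, $$Z_{W,j}=\psi_W\bigl(\overline{C_{q,n,j}}\bigr)=S_{W,j}^{q-1},$$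 where $S_{W,j}^{q-1}=\{y^{q-1}:y\in S_{W,j}\}$.
   Context: $\mathrm{PG}(n-1,q)=(\mathbb{F}_q^n\setminus\{\vec 0\})/\sim$, where $\vec x\sim\vec y$ iff $\vec x=\lambda\vec y$ for some $\lambda\in\mathbb{F}_q^\ast$; the class of $(x_0,\dots,x_{n-1})$ is written $(x_0:\dots:x_{n-1})$. $\mu_\ell\subseteq\mathbb{F}_{q^n}$ is the set of all $\ell$-th roots of unity. $\mathrm{Tr}_q^{q^n}$ is the trace from $\mathbb{F}_{q^n}$ to $\mathbb{F}_q$. The dual basis $B$ of $W$ is the basis with $\mathrm{Tr}_q^{q^n}(\beta_i\omega_j)=1$ if $i=j$ and $0$ otherwise. The map $\psi_W:\mathrm{PG}(n-1,q)\to\mu_{\frac{q^n-1}{q-1}}$ is $\psi_W(x_0:\dots:x_{n-1})=\bigl(\sum_{j=0}^{n-1}x_j\omega_j\bigr)^{q-1}$. For $0\leq i\leq n-1$, $T_{W,i}(x)=\sum_{k=0}^{n-1}(-1)^{k(n-1)}c_i^{q^k}x^{\frac{q^k-1}{q-1}}$, where $c_i$ is the $(i,0)$-cofactor of the $n\times n$ matrix $M_W=\bigl(\omega_i^{q^k}\bigr)_{0\leq i,k\leq n-1}$ (rows indexed by $i$, columns by $k$, starting at $0$), i.e. $(-1)^i$ times the minor obtained by deleting row $i$ and column $0$. *)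

(* Defs.v *)
From HB Require Import structures.
From mathcomp Require Import all_boot all_order all_algebra all_field.

Set Implicit Arguments.
Unset Strict Implicit.
Unset Printing Implicit Defensive.

Import GRing.Theory.
Local Open Scope ring_scope.
Local Open Scope quotient_scope.

(* Indexed analogue of finset's partition: distinct indices must give
   disjoint blocks. *)
Definition family_partition (I T : finType) (P : I -> {set T}) (D : {set T}) :=
  [/\ D = \bigcup_i P i,
      forall i j, i != j -> [disjoint P i & P j]
    & forall i, P i != set0].

Section ProjectiveSpace.
Variables (F : finFieldType) (n : nat).

Record nzvec := NzVec { nzval :> 'rV[F]_n; _ : nzval != 0 }.

HB.instance Definition _ := [isSub for nzval].
HB.instance Definition _ := [Finite of nzvec by <:].

Definition proportional (x y : nzvec) :=
  [exists l : F, (l != 0) && (nzval x == l *: nzval y)].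

Lemma proportionalP (x y : nzvec) :
  reflect (exists2 l : F, l != 0 & nzval x = l *: nzval y) (proportional x y).
Proof.
apply: (iffP existsP) => [[l /andP[l0 /eqP xy]]|[l l0 ->]]; first by exists l.
by exists l; rewrite l0 eqxx.
Qed.

Lemma proportional_equiv : equiv_class_of proportional.
Proof.
split=> [x|x y|y x z].
- by apply/proportionalP; exists 1; rewrite ?oner_neq0 ?scale1r.
- have sym u v : proportional u v -> proportional v u.
    case/proportionalP=> l l0 uv; apply/proportionalP; exists l^-1.
      by rewrite invr_eq0.
    by rewrite uv scalerA mulVf ?scale1r.
  by apply/idP/idP; apply: sym.
- case/proportionalP=> l l0 xy /proportionalP[m m0 yz].
  by apply/proportionalP; exists (l * m); rewrite ?mulf_neq0 // xy yz scalerA.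
Qed.

Canonical proportional_equiv_rel :=
  EquivRelPack proportional_equiv.

(* n is the number of homogeneous coordinates, so this is PG(n-1, F). *)
Definition PG := {eq_quot proportional}.
HB.instance Definition _ := Quotient.on PG.
HB.instance Definition _ := Finite.copy PG (can_type (@reprK _ PG)).

Definition PG_point (v : 'rV[F]_n) (v0 : v != 0) : PG := \pi_PG (NzVec v0).

End ProjectiveSpace.

Arguments PG : clear implicits.

Section Definitions.
Variables (F : finFieldType) (L : fieldExtType F).
(* finvect_type L is L, seen moreover as a finite field and as a splitting
   field (hence Galois extension) of F. *)
Local Notation K := (finvect_type L).
Local Notation q := #|F|.

(* galTrace takes its values in the subfield 1%VS of K; Tr x is that value as
   an element of F, see TrE. *)
Definition Tr (x : K) : F :=
  coord [tuple (1 : K)] ord0 (galTrace 1%AS {:K}%AS x).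

Lemma TrE (x : K) : (Tr x)%:A = galTrace 1%AS {:K}%AS x.
Proof.
have gal1 : galois 1%AS {:K}%AS by apply: finField_galois; apply: subvf.
have free1 : free [tuple (1 : K)] by rewrite seq1_free oner_neq0.
rewrite /Tr; have /vlineP[k ->] := mem_galTrace gal1 (memvf x).
rewrite linearZ /=.
by rewrite (coord_free (X := [tuple (1 : K)]) ord0 ord0 free1) mulr1.
Qed.

Definition mu (l : nat) : {set K} := [set x | l.-unity_root x].

Section Basis.
Variable n : nat.
Implicit Types (W B : n.-tuple K) (i j : 'I_n).

Definition dual_basis W B :=
  basis_of {:K} B /\
  forall i j, Tr (tnth B i * tnth W j) = (i == j)%:R.

(* Evaluated at a representative; psi_WE gives independence of the choice. *)
Definition psi_W W (P : PG F n) : K :=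
  (\sum_(j < n) (repr P : 'rV[F]_n) 0 j *: tnth W j) ^+ q.-1.

Lemma psi_WE W (v : 'rV[F]_n) (v0 : v != 0) :
  psi_W W (PG_point v0) = (\sum_(j < n) v 0 j *: tnth W j) ^+ q.-1.
Proof.
rewrite /psi_W; have /eqmodP/proportionalP[l l0 ->] :
  repr (PG_point v0) = NzVec v0 %[mod PG F n] by rewrite reprK.
rewrite (eq_bigr (fun j => l *: (v 0 j *: tnth W j))); last first.
  by move=> j _; rewrite mxE scalerA.
rewrite -scaler_sumr exprZn.
suff -> : l ^+ q.-1 = 1 by rewrite scale1r.
apply: (mulfI l0); rewrite -exprS mulr1 prednK ?expf_card //.
by apply/card_gt0P; exists 0.
Qed.

Definition M_W W : 'M[K]_n := \matrix_(i, k) tnth W i ^+ (q ^ k).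

(* The index 0, available in 'I_n because 'I_n is inhabited by i. *)
Definition ord_zero i : 'I_n := Ordinal (leq_ltn_trans (leq0n i) (ltn_ord i)).

Definition T_W W i (x : K) : K :=
  \sum_(k < n) (-1) ^+ (k * n.-1) * cofactor (M_W W) i (ord_zero i) ^+ (q ^ k)
               * x ^+ ((q ^ k).-1 %/ q.-1).

Definition S_W B j : {set K} :=
  [set y | [&& y != 0, Tr (tnth B j * y) != 0
             & [forall i : 'I_n, (j < i)%N ==> (Tr (tnth B i * y) == 0)]]].

Definition Z_W W j : {set K} :=
  [set x in mu ((q ^ n).-1 %/ q.-1) |
     (T_W W j x != 0) && [forall i : 'I_n, (j < i)%N ==> (T_W W i x == 0)]].

Definition Cvec B j (x : K) : 'rV[F]_n :=
  \row_i (if (i < j)%N then Tr (tnth B i * x) / Tr (tnth B j * x)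
          else (i == j)%:R).

Lemma Cvec_neq0 B j (x : K) : Cvec B j x != 0.
Proof.
apply/eqP => /rowP/(_ j); rewrite !mxE ltnn eqxx => /eqP.
by rewrite oner_eq0.
Qed.

Definition C_bar B j : {set PG F n} := [set PG_point (Cvec_neq0 B j x) | x in S_W B j].

End Basis.
End Definitions.

(* Main.v *)
From HB Require Import structures.
Require Import Defs.
From mathcomp Require Import all_boot all_order all_fingroup all_algebra.
From mathcomp Require Import all_solvable all_field.

Set Implicit Arguments.
Unset Strict Implicit.
Unset Printing Implicit Defensive.

Import GRing.Theory.
Local Open Scope ring_scope.

(* The matrix of conjugates of the dual basis B is inverse to M_W, so the
   cofactor c_i equals D * beta_i with D = det M_W.  Since D^q = (-1)^(n-1) D,
   the signs in T_{W,i} cancel and, for y <> 0,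
     T_{W,i}(y^(q-1)) = (D / y) Tr(beta_i y).
   By Hilbert's theorem 90, mu_{(q^n-1)/(q-1)} is the set of all y^(q-1), whence
   Z_{W,j} = S_{W,j}^(q-1).  Finally y = sum_i Tr(beta_i y) omega_i shows that
   psi_W maps the point of the j-th cell attached to y in S_{W,j} to y^(q-1). *)

Lemma big_cycle (gT : finGroupType) (x : gT) (R : Type) (idx : R)
    (op : Monoid.com_law idx) (f : gT -> R) :
  \big[op/idx]_(y in <[x]>%g) f y = \big[op/idx]_(i < #[x]%g) f (x ^+ i)%g.
Proof.
have injx : injective (fun i : 'I_#[x]%g => (x ^+ i)%g).
  move=> i j /eqP; rewrite eq_expg_mod_order !modn_small // => /eqP.
  exact: val_inj.
rewrite -(big_image op idx (fun i : 'I_#[x]%g => (x ^+ i)%g) predT f).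
rewrite big_uniq; last by rewrite map_inj_uniq ?enum_uniq.
apply: eq_bigl => y; apply/idP/imageP => [/cyclePmin[i ltix ->]|[i _ ->]].
  by exists (Ordinal ltix).
exact: mem_cycle.
Qed.

(** If one index were smaller, its vanishing condition would kill the value at the other. This gives
    disjointness of both the [S_W] and the [Z_W] cells. *)
Lemma last_nonzero_uniq (V : nmodType) (n : nat) (f : 'I_n -> V) (i j : 'I_n) :
  f i != 0 -> [forall k : 'I_n, (i < k)%N ==> (f k == 0)] ->
  f j != 0 -> [forall k : 'I_n, (j < k)%N ==> (f k == 0)] -> i = j.
Proof.
move=> fi /forallP/(_ j) fi0 fj /forallP/(_ i) fj0; apply: val_inj => /=.
by case: ltngtP fi0 fj0; rewrite //= ?(negPf fi) ?(negPf fj).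
Qed.

(** * Frobenius, trace, norm and roots of unity *)

Section FiniteField.
Variables (F : finFieldType) (L : fieldExtType F) (n : nat).
Hypothesis dimL : \dim {:L} = n.
Local Notation K := (finvect_type L).
Local Notation q := #|F|.
Implicit Types (x y : K).

Lemma frobenius_gal : {alpha : gal_of {:K} |
  'Gal({:K} / 1)%g = <[alpha]>%g /\ #[alpha]%g = n
  & forall x, alpha x = x ^+ q}.
Proof.
have [alpha /eqP gen_alpha alphaE] := finField_galois_generator (sub1v {:K}).
exists alpha => [|x]; last by rewrite alphaE ?memvf //= dimv1 expn1.
split=> //; rewrite orderE -gen_alpha -galois_dim ?finField_galois ?sub1v //.
by rewrite dimv1 divn1 -dimL.
Qed.

Lemma gal_iter (alpha : gal_of {:K}) (alphaE : forall x, alpha x = x ^+ q) x k :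
  (alpha ^+ k)%g x = x ^+ (q ^ k).
Proof.
elim: k => [|k IHk]; first by rewrite gal_id expr1.
by rewrite expgSr galM ?memvf // IHk alphaE -exprM expnSr.
Qed.

Lemma Tr_sum_expr x : (Tr x)%:A = \sum_(k < n) x ^+ (q ^ k).
Proof.
have [alpha [galE ordE] alphaE] := frobenius_gal.
rewrite TrE /galTrace galE big_cycle /= ordE.
by apply: eq_bigr => k _; exact: gal_iter.
Qed.

Lemma galNorm_prod_expr x : galNorm 1 {:K} x = \prod_(k < n) x ^+ (q ^ k).
Proof.
have [alpha [galE ordE] alphaE] := frobenius_gal.
rewrite /galNorm galE big_cycle /= ordE.
by apply: eq_bigr => k _; exact: gal_iter.
Qed.

Lemma expr_card_finvect x : x ^+ (q ^ n) = x.
Proof.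
have [alpha [_ <-] alphaE] := frobenius_gal.
by rewrite -(gal_iter alphaE) expg_order gal_id.
Qed.

Lemma Tr_is_scalar : scalar (@Tr F L).
Proof.
move=> a x y; rewrite /Tr -linearP; congr (coord _ _ _).
rewrite /galTrace scaler_sumr -big_split.
by apply: eq_bigr => s _; rewrite linearP.
Qed.

HB.instance Definition _ :=
  GRing.isLinear.Build F K F *%R (@Tr F L) Tr_is_scalar.

Lemma mu_power : mu L ((q ^ n).-1 %/ q.-1) = [set y ^+ q.-1 | y : K & y != 0].
Proof.
have q_gt1 : (1 < q)%N := finNzRing_gt1 F.
have q1_gt0 : (0 < q.-1)%N by case: (q) q_gt1 => [|[]].
(* With this exponent, [x] is a root of unity exactly when its norm to [F] is 1. *)
have divE : ((q ^ n).-1 %/ q.-1 = \sum_(k < n) q ^ k)%N.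
  by rewrite predn_exp mulKn.
apply/setP => x; rewrite inE unity_rootE divE; apply/eqP/imsetP => [xN|[y]].
  have [alpha [galE _] alphaE] := frobenius_gal.
  have gen : cyclic.generator 'Gal({:K} / 1)%g alpha by rewrite /generator galE.
  have := @Hilbert's_theorem_90 _ _ _ _ _ _ gen (memvf x).
  rewrite galNorm_prod_expr prodrXr xN eqxx => /elimT/(_ isT)[b [_ b0] ->].
  (* Hilbert 90 writes [x] as [b / alpha b], that is, [b] to the power [1 - q], hence the
     inverse. *)
  exists b^-1; first by rewrite inE invr_eq0.
  have -> : alpha b = b * b ^+ q.-1 by rewrite alphaE -exprS prednK // ltnW.
  by rewrite invfM mulrA divff // mul1r exprVn.
rewrite inE => y0 ->; rewrite -exprM -predn_exp.
apply: (mulfI y0); rewrite -exprS mulr1 prednK ?expn_gt0 ?(ltnW q_gt1) //.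
exact: expr_card_finvect.
Qed.


(* Frobenius shifts the columns of [M_W W] cyclically, which is a permutation of
   sign [(-1) ^+ n.-1]; this accounts for the signs in [T_W]. *)
Lemma det_M_W_expr (W : n.-tuple K) :
  \det (M_W W) ^+ q = (-1) ^+ n.-1 * \det (M_W W).
Proof.
have [alpha _ alphaE] := frobenius_gal; rewrite -alphaE -det_map_mx.
have WK j : tnth W j ^+ (q ^ n) = tnth W j by apply: expr_card_finvect.
case: n W WK => [|m] W WK; first by rewrite !det_mx00 mulr1.
(* [s] sends [k] to [k + 1] and the last index to 0; the wrap-around is [WK]. *)
pose s : 'S_m.+1 := lift_perm ord_max ord0 1.
have -> : map_mx alpha (M_W W) = col_perm s (M_W W).
  apply/matrixP => i j; rewrite !mxE alphaE -exprM -expnSr.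
  case: (unliftP ord_max j) => [k ->|->]; last by rewrite lift_perm_id expr1 WK.
  by rewrite lift_perm_lift perm1 lift_max lift0.
rewrite col_permE det_mulmx det_perm mulrC odd_permV odd_lift_perm odd_perm1.
by rewrite addbF /= addbF signr_odd.
Qed.

(** * Dual basis, cofactors and values of [T_W] *)

Variables W B : n.-tuple K.
Hypothesis dualWB : dual_basis W B.

(** Entry [(i, j)] of the product is the sum of the conjugates of [omega_i * beta_j], which is its
    trace. *)
Lemma M_W_dual : M_W W *m \matrix_(k, j) tnth B j ^+ (q ^ k) = 1%:M.
Proof.
apply/matrixP => i j; rewrite !mxE.
under eq_bigr => k _ do rewrite !mxE -exprMn (mulrC (tnth W i)).
have [_ dual] := dualWB; rewrite -Tr_sum_expr dual eq_sym.
by case: eqP; rewrite ?scale1r ?scale0r.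
Qed.

Lemma det_M_W_neq0 : \det (M_W W) != 0.
Proof.
by have := mulmx1_unit M_W_dual; rewrite unitmxE unitfE => -[].
Qed.

(** The adjugate is the determinant times the inverse, and row 0 of the inverse consists of the
    [beta_i] themselves, with exponent [q ^ 0]. *)
Lemma cofactor_M_W i :
  cofactor (M_W W) i (ord_zero i) = \det (M_W W) * tnth B i.
Proof.
have adjE : \adj (M_W W) = \det (M_W W) *: \matrix_(k, j) tnth B j ^+ (q ^ k).
  by rewrite -mul_scalar_mx -mul_adj_mx -mulmxA M_W_dual mulmx1.
by have := congr1 (fun A : 'M_n => A (ord_zero i) i) adjE; rewrite !mxE expr1.
Qed.

Lemma T_W_power i y : y != 0 ->
  T_W W i (y ^+ q.-1) = \det (M_W W) / y * (Tr (tnth B i * y))%:A.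
Proof.
move=> y0; rewrite Tr_sum_expr mulr_sumr; apply: eq_bigr => k _.
have q_gt1 : (1 < q)%N := finNzRing_gt1 F.
have detE : \det (M_W W) ^+ (q ^ k) = (-1) ^+ (k * n.-1) * \det (M_W W).
  elim: (nat_of_ord k) => [|m IHm]; first by rewrite expr1 mul1r.
  rewrite expnSr exprM IHm exprMn det_M_W_expr mulrA mulSn addnC exprD.
  congr (_ * _ * _); rewrite -exprM mulnC exprM.
  (* Frobenius is a ring morphism, so it fixes -1 in every characteristic. *)
  have [alpha _ alphaE] := frobenius_gal.
  by rewrite -alphaE rmorphN1.
have powE : (y ^+ q.-1) ^+ ((q ^ k).-1 %/ q.-1) = y ^+ (q ^ k).-1.
  by rewrite -exprM mulnC divnK // predn_exp dvdn_mulr.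
(* Splitting off one factor [y] produces the common factor [D / y]. *)
have -> : (tnth B i * y) ^+ (q ^ k)
    = tnth B i ^+ (q ^ k) * (y * y ^+ (q ^ k).-1).
  by rewrite exprMn -exprS prednK // expn_gt0 ltnW.
by rewrite cofactor_M_W exprMn detE powE [RHS]mulrACA mulKf // -!mulrA signrMK.
Qed.

Lemma T_W_power_neq0 i y : y != 0 ->
  (T_W W i (y ^+ q.-1) != 0) = (Tr (tnth B i * y) != 0).
Proof.
move=> y0; rewrite T_W_power // !mulf_eq0 invr_eq0 scaler_eq0 oner_eq0.
by rewrite (negPf det_M_W_neq0) (negPf y0) /= orbF.
Qed.

Lemma Z_W_power j : Z_W W j = [set y ^+ q.-1 | y in S_W B j].
Proof.
have vanish y : y != 0 ->
    [forall i : 'I_n, (j < i)%N ==> (T_W W i (y ^+ q.-1) == 0)]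
    = [forall i : 'I_n, (j < i)%N ==> (Tr (tnth B i * y) == 0)].
  move=> y0; apply: eq_forallb => i.
  by rewrite -[T_W _ _ _ == 0]negbK T_W_power_neq0 // negbK.
apply/setP => x; rewrite inE mu_power; apply/andP/imsetP => [[]|[y + ->]].
  case/imsetP=> y; rewrite inE => y0 -> Zx; exists y => //.
  by rewrite inE y0 -T_W_power_neq0 // -vanish.
rewrite inE => /and3P[y0 Tj Ti]; rewrite T_W_power_neq0 // vanish // Tj Ti.
by split=> //; apply: imset_f; rewrite inE.
Qed.

(** * Coordinates, cells and [psi_W] *)

Lemma Tr_dual_sum (v : 'I_n -> F) i :
  Tr (tnth B i * \sum_(j < n) v j *: tnth W j) = v i.
Proof.
have [_ dual] := dualWB.
rewrite mulr_sumr linear_sum (bigD1 i) //= big1 => [|j ne_ji].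
  by rewrite -scalerAr linearZ /= dual eqxx mulr1 addr0.
by rewrite -scalerAr linearZ /= dual eq_sym (negPf ne_ji) mulr0.
Qed.

Hypothesis basisW : basis_of {:K} W.

Lemma dual_coord y : y = \sum_(j < n) Tr (tnth B j * y) *: tnth W j.
Proof.
rewrite [LHS](coord_basis basisW (memvf y)).
apply: eq_bigr => j _; rewrite -(tnth_nth 0); congr (_ *: _).
rewrite [in RHS](coord_basis basisW (memvf y)).
under eq_bigr => k _ do rewrite -(tnth_nth 0).
by rewrite Tr_dual_sum.
Qed.

Lemma S_W_cover y : y != 0 -> exists j, y \in S_W B j.
Proof.
move=> y0; have [i Ti] : exists i, Tr (tnth B i * y) != 0.
  apply/existsP; apply: contraR y0 => /existsPn T0; rewrite (dual_coord y).
  by apply/eqP/big1 => i _; rewrite (eqP (negPn (T0 i))) scale0r.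
(* The cell of [y] is given by its last nonzero coordinate. *)
case: (@arg_maxnP _ i (fun i => Tr (tnth B i * y) != 0) val Ti) => j Tj max_j.
exists j; rewrite inE y0 Tj; apply/forallP => k; apply/implyP => lt_jk.
by apply: contraLR lt_jk => /max_j; rewrite -leqNgt.
Qed.

Lemma S_W_disjoint i j : i != j -> [disjoint S_W B i & S_W B j].
Proof.
apply: contraNT => /pred0Pn[y /=]; rewrite !inE.
case/andP=> /and3P[_ yi yi0] /and3P[_ yj yj0].
by rewrite (last_nonzero_uniq yi yi0 yj).
Qed.

Lemma Z_W_disjoint i j : i != j -> [disjoint Z_W W i & Z_W W j].
Proof.
apply: contraNT => /pred0Pn[x /=]; rewrite !inE.
case/andP=> /and3P[_ xi xi0] /and3P[_ xj xj0].
by rewrite (last_nonzero_uniq xi xi0 xj).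
Qed.

(** Supplies the witness of nonemptiness for the [j]-th block of all three partitions. *)
Lemma basis_in_S_W j : tnth W j \in S_W B j.
Proof.
have [_ dual] := dualWB.
rewrite inE dual eqxx oner_neq0 (free_not0 (basis_free basisW)) ?mem_tnth //=.
apply/forallP => i; apply/implyP => lt_ji; rewrite dual.
by rewrite -val_eqE gtn_eqF.
Qed.

(** [Cvec] is the coordinate vector of [y] normalised by its last nonzero entry; its zeros beyond
    [j] agree with [y] because [y] lies in [S_W B j]. *)
Lemma sum_Cvec j y : y \in S_W B j ->
  \sum_(i < n) Cvec B j y 0 i *: tnth W i = (Tr (tnth B j * y))^-1 *: y.
Proof.
rewrite inE => /and3P[y0 Tj /forallP Ti].
rewrite [X in _ *: X](dual_coord y) scaler_sumr; apply: eq_bigr => i _.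
rewrite scalerA mxE mulrC; congr (_ *: _).
case: (ltngtP i j) (Ti i) => [_ _|gt_ij /eqP ->|/val_inj -> _] //.
  by rewrite -val_eqE /= gtn_eqF // mulr0.
by rewrite eqxx mulVf.
Qed.

(** The normalising scalar is a nonzero element of [F], so its power [q - 1] is 1. *)
Lemma psi_W_Cvec j y : y \in S_W B j ->
  psi_W W (PG_point (Cvec_neq0 B j y)) = y ^+ q.-1.
Proof.
move=> Sy; rewrite psi_WE sum_Cvec // exprZn.
suff -> : (Tr (tnth B j * y))^-1 ^+ q.-1 = 1 by rewrite scale1r.
have Tj0 : Tr (tnth B j * y) != 0 by move: Sy; rewrite inE => /and3P[].
have q_gt0 : (0 < q)%N by apply/card_gt0P; exists 0.
rewrite exprVn; apply/eqP; rewrite invr_eq1; apply/eqP/(mulfI Tj0).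
by rewrite -exprS prednK // expf_card mulr1.
Qed.

Lemma psi_W_C_bar j :
  psi_W W @: C_bar B j = [set y ^+ q.-1 | y in S_W B j].
Proof.
by rewrite -imset_comp; apply: eq_in_imset => y Sy /=; exact: psi_W_Cvec.
Qed.

(* The image blocks [psi_W W @: C_bar B i = Z_W W i] are already disjoint. *)
Lemma C_bar_disjoint i j : i != j -> [disjoint C_bar B i & C_bar B j].
Proof.
move=> /Z_W_disjoint/pred0P Zij; apply/pred0P => P /=.
apply: contraFF (Zij (psi_W W P)) => /andP[Pi Pj] /=.
by rewrite !Z_W_power -!psi_W_C_bar !imset_f.
Qed.

Lemma C_bar_cover (P : PG F n) : exists j, P \in C_bar B j.
Proof.
pose v : 'rV[F]_n := generic_quotient.repr P.
pose y := \sum_(j < n) v 0 j *: tnth W j.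
have Try i : Tr (tnth B i * y) = v 0 i by apply: Tr_dual_sum.
have y0 : y != 0.
  apply: contra (valP (generic_quotient.repr P)) => /eqP yE.
  apply/eqP/rowP => i.
  by rewrite mxE -[LHS]Try yE mulr0 linear0.
have [j Sy] := S_W_cover y0; exists j; apply/imsetP; exists y => //.
move: Sy; rewrite inE Try => /and3P[_ vj /forallP vi].
(* The traces of [y] are the coordinates of [v], so undoing the normalisation of [Cvec] means
   multiplying by [v 0 j]. *)
rewrite -[LHS]reprK; apply/eqmodP/proportionalP; exists (v 0 j) => //=.
apply/rowP => i; rewrite !mxE !Try -/v.
case: (ltngtP i j) (vi i) => [_ _|gt_ij /=|/val_inj -> _].
- by rewrite mulrC divfK.
- by rewrite Try -val_eqE /= gtn_eqF // => /eqP ->; rewrite mulr0.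
by rewrite eqxx mulr1.
Qed.

End FiniteField.

Theorem mainTheorem2 (F : finFieldType) (L : fieldExtType F) (n : nat)
    (hn : (2 <= n)%N) (hL : \dim {:L} = n)
    (W B : n.-tuple (finvect_type L))
    (hW : basis_of {:finvect_type L} W) (hB : dual_basis W B) :
  [/\ family_partition (S_W B) [set y | y != 0],
      family_partition (Z_W W) (mu L ((#|F| ^ n).-1 %/ #|F|.-1)),
      family_partition (C_bar B) [set: PG F n]
    & forall j : 'I_n,
        Z_W W j = psi_W W @: C_bar B j /\
        psi_W W @: C_bar B j = [set y ^+ #|F|.-1 | y in S_W B j]].
Proof.
have Sn0 j : tnth W j \in S_W B j by apply: basis_in_S_W.
split.
- split=> [|i j|j]; [|exact: S_W_disjoint|by apply/set0Pn; exists (tnth W j)].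
  apply/setP => y; rewrite inE; apply/idP/bigcupP => [y0|[j _]].
    by have [j Sy] := S_W_cover hB hW y0; exists j.
  by rewrite inE => /and3P[].
- split=> [|i j|j].
  + apply/setP => x; apply/idP/bigcupP => [|[j _]]; last first.
      by rewrite inE => /andP[].
    (* The covering of the roots of unity is the image of that of the nonzero elements under the
       power [q - 1]. *)
    rewrite (mu_power hL) => /imsetP[y]; rewrite inE => y0 ->.
    have [j Sy] := S_W_cover hB hW y0; exists j => //.
    by rewrite (Z_W_power hL hB); apply: imset_f.
  + exact: Z_W_disjoint.
  + rewrite (Z_W_power hL hB); apply/set0Pn.
    by exists (tnth W j ^+ #|F|.-1); apply: imset_f.
- split=> [|i j|j].
  + apply/setP => P; rewrite inE; apply/esym/bigcupP.
    by have [j Pj] := C_bar_cover hB hW P; exists j.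
  + exact: (C_bar_disjoint hL hB hW).
  + apply/set0Pn; exists (PG_point (Cvec_neq0 B j (tnth W j))); exact: imset_f.
by move=> j; rewrite (psi_W_C_bar hB hW) (Z_W_power hL hB).
Qed.
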